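(* Let $r\ge 1$ be an integer, let $\mathbb{A}=\{1,2,\ldots,r\}$, and let $\mathcal{R}$ be the right quantum algebra on $\mathbb{A}$. Let $$\mathrm{Bos}=\sum_{w\in\mathbb{A}^*}\binom{\overline{w}}{w},\qquad \mathrm{Ferm}=\sum_{J\subseteq\mathbb{A}}(-1)^{|J|}\sum_{\sigma\in\mathcal{S}_J}(-1)^{\mathrm{inv}\,\sigma}\begin{pmatrix}\sigma(i_1)&\sigma(i_2)&\cdots&\sigma(i_l)\\ i_1&i_2&\cdots&i_l\end{pmatrix},$$ where in the second sum $J=\{i_1<i_2<\cdots<i_l\}$, both regarded as elements of $\mathcal{R}$. Then the identity $$\mathrm{Ferm}\times\mathrm{Bos}=1$$ holds in $\mathcal{R}$.
   Context: A biword on $\mathbb{A}=\{1,\ldots,r\}$ is a $2\times n$ matrix ($n\ge 0$) with entries in $\mathbb{A}$, written $\binom{u}{w}$ with top word $u$ and bottom word $w$, both words of length $n$ over $\mathbb{A}$; $n$ is its length. A biword is viewed as a word in the biletters $\binom{x}{a}$ ($x,a\in\mathbb{A}$; not binomial coefficients), and the product of biwords is concatenation; the biword of length $0$ is $1$. Let $\mathcal{B}$ be the set of all biwords and let $\mathcal{A}=\mathbb{Z}\langle\langle\mathcal{B}\rangle\rangle$ be the $\mathbb{Z}$-algebra of all (possibly infinite) formal sums $\sum_{\alpha\in\mathcal{B}}c(\alpha)\alpha$, $c(\alpha)\in\mathbb{Z}$, with product extending concatenation. The right quantum algebra $\mathcal{R}$ is the associative algebra which is the quotient of $\mathcal{A}$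 by the (two-sided) ideal $\mathcal{I}$ generated by the commutation relations (R1) $\binom{xy}{aa}=\binom{yx}{aa}$, (R2) $\binom{xy}{ab}=\binom{yx}{ab}+\binom{yx}{ba}-\binom{xy}{ba}$, for all $a,b,x,y\in\mathbb{A}$ with $x\ne y$. Elements of $\mathcal{A}$ are identified with their images in $\mathcal{R}$ under the canonical homomorphism. Notation: $\mathbb{A}^*$ is the free monoid generated by $\mathbb{A}$, i.e. the set of all words (including the empty word) over $\mathbb{A}$; $\overline{w}$ is the non-decreasing rearrangement of the word $w$; $\mathcal{S}_J$ is the group of permutations of the set $J$; $\mathrm{inv}\,\sigma$ is the number of inversions of $\sigma$ (pairs $i<j$ in $J$ with $\sigma(i)>\sigma(j)$). The term $J=\emptyset$ contributes $1$ to $\mathrm{Ferm}$.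
   Formalization: The ideal generated by the commutation relations is replaced by its closure in the topology of formal series (coefficientwise convergence); for the ideal of finite sums the identity fails for every r ≥ 2. *)

(* Defs.v *)
From HB Require Import structures.
From mathcomp Require Import all_boot all_order all_algebra all_fingroup.
From mathcomp Require Import boolp classical_sets.

Set Implicit Arguments.
Unset Strict Implicit.
Unset Printing Implicit Defensive.

Import GRing.Theory.
Local Open Scope quotient_scope.
Local Open Scope ring_scope.

(* The alphabet {1 < ... < r} is represented by ['I_r] with its usual order.
   A biletter (x, a) has top letter x and bottom letter a; a biword, i.e. a
   2 x n matrix, is the sequence of its columns. *)
Definition biword (r : nat) : Type := seq ('I_r * 'I_r).
Definition top (r : nat) (al : biword r) : seq 'I_r := unzip1 al.
Definition bottom (r : nat) (al : biword r) : seq 'I_r := unzip2 al.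

(* The algebra Z<<B>> of possibly infinite formal sums of biwords; the function
   [coef f] gives the coefficients.  The record keeps the convolution product
   apart from the pointwise product of functions. *)
Record series (r : nat) := Series { coef : biword r -> int }.

HB.instance Definition _ (r : nat) := gen_eqMixin (series r).
HB.instance Definition _ (r : nat) := gen_choiceMixin (series r).

Section SeriesRing.
Variable r : nat.
Implicit Types (f g h : series r) (al be : biword r).

Lemma seriesP f g : coef f =1 coef g -> f = g.
Proof. by case: f g => [f] [g] /= /funext ->. Qed.

Definition series0 : series r := Series (fun=> 0).
Definition seriesN f := Series (fun al => - coef f al).
Definition seriesD f g := Series (fun al => coef f al + coef g al).

(* [biw al] is the biword [al] regarded as a formal sum. *)
Definition biw al : series r := Series (fun be => (be == al)%:R).

(* The product extending concatenation: sum over all factorisations of [al]. *)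
Definition seriesM f g := Series (fun al =>
  \sum_(i < (size al).+1) coef f (take i al) * coef g (drop i al)).

Lemma seriesDA : associative seriesD.
Proof. by move=> f g h; apply: seriesP => al /=; rewrite addrA. Qed.
Lemma seriesDC : commutative seriesD.
Proof. by move=> f g; apply: seriesP => al /=; rewrite addrC. Qed.
Lemma series0D : left_id series0 seriesD.
Proof. by move=> f; apply: seriesP => al /=; rewrite add0r. Qed.
Lemma seriesND : left_inverse series0 seriesN seriesD.
Proof. by move=> f; apply: seriesP => al /=; rewrite addNr. Qed.

HB.instance Definition _ :=
  GRing.isZmodule.Build (series r) seriesDA seriesDC series0D seriesND.

Let shift (x : 'I_r * 'I_r) f := Series (fun al => coef f (x :: al)).

Let seriesM_nil f g : coef (seriesM f g) [::] = coef f [::] * coef g [::].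
Proof. by rewrite /= big_ord_recl big_ord0 addr0. Qed.

Let seriesM_cons f g x al : coef (seriesM f g) (x :: al) =
  coef f [::] * coef g (x :: al) + coef (seriesM (shift x f) g) al.
Proof. by rewrite /= big_ord_recl. Qed.

Lemma seriesMDl : left_distributive seriesM +%R.
Proof.
move=> f g h; apply: seriesP => al /=; rewrite -big_split /=.
by apply: eq_bigr => i _; rewrite mulrDl.
Qed.

Lemma seriesMDr : right_distributive seriesM +%R.
Proof.
move=> f g h; apply: seriesP => al /=; rewrite -big_split /=.
by apply: eq_bigr => i _; rewrite mulrDr.
Qed.

Let seriesMA_coef al f g h :
  coef (seriesM f (seriesM g h)) al = coef (seriesM (seriesM f g) h) al.
Proof.
elim: al f g h => [|x al IHal] f g h.
  by rewrite !seriesM_nil mulrA.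
rewrite [LHS]seriesM_cons [RHS]seriesM_cons seriesM_nil IHal seriesM_cons.
pose cg := Series (fun be => coef f [::] * coef (shift x g) be).
have -> : shift x (seriesM f g) = cg + seriesM (shift x f) g.
  by apply: seriesP => be; rewrite [LHS]seriesM_cons.
rewrite seriesMDl mulrDr mulrA -addrA; congr (_ + _); congr (_ + _).
by rewrite /= mulr_sumr; apply: eq_bigr => i _; rewrite mulrA.
Qed.

Lemma seriesMA : associative seriesM.
Proof. by move=> f g h; apply: seriesP => al; apply: seriesMA_coef. Qed.

Lemma series1M : left_id (biw [::]) seriesM.
Proof.
move=> f; apply: seriesP => al /=; rewrite big_ord_recl take0 drop0 mul1r.
rewrite big1 ?addr0 // => -[i Hi] _; rewrite -size_eq0 size_take /=.
by case: al Hi => //= x al Hi; case: ifP => _; rewrite mul0r.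
Qed.

Lemma seriesM1 : right_id (biw [::]) seriesM.
Proof.
move=> f; apply: seriesP => al /=; rewrite big_ord_recr /= take_size drop_size.
rewrite mulr1 big1 ?add0r // => -[i Hi] _; rewrite -size_eq0 size_drop /=.
by rewrite subn_eq0 leqNgt Hi mulr0.
Qed.

HB.instance Definition _ := GRing.Zmodule_isPzRing.Build (series r)
  seriesMA series1M seriesM1 seriesMDl seriesMDr.

Lemma biwM al be : biw al * biw be = biw (al ++ be).
Proof.
apply: seriesP => ga /=.
case: (eqVneq ga (al ++ be)) => [->|ne]; last first.
  rewrite big1 // => i _; case: eqVneq => [Et|]; last by rewrite mul0r.
  case: eqVneq => [Ed|]; last by rewrite mulr0.
  by case/eqP: ne; rewrite -Et -Ed cat_take_drop.
have lt_al : (size al < (size (al ++ be)).+1)%N by rewrite size_cat ltnS leq_addr.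
rewrite (bigD1 (Ordinal lt_al)) //= take_size_cat // drop_size_cat // !eqxx.
rewrite big1 ?addr0 // => i ne_i; case: eqVneq => [Et|]; last by rewrite mul0r.
case/eqP: ne_i; apply: val_inj; rewrite /=.
have := congr1 size Et; rewrite size_takel //.
by rewrite -ltnS ltn_ord.
Qed.

End SeriesRing.

Section TwoSidedIdeal.
Variable A : pzRingType.

Definition two_sided_ideal (I : set A) : Prop :=
  [/\ I 0, forall u v, I u -> I v -> I (u - v),
      forall u v, I v -> I (u * v) & forall u v, I u -> I (u * v)].

Definition ideal_generated (S : set A) : set A := smallest two_sided_ideal S.

Lemma ideal_generatedP (S : set A) : two_sided_ideal (ideal_generated S).
Proof.
split=> [I [[]]//|u v Iu Iv I [Iid SI]|u v Iv I [Iid SI]|u v Iu I [Iid SI]].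
- by case: (Iid) => _ IB _ _; apply: IB; [apply: Iu|apply: Iv].
- by case: (Iid) => _ _ IM _; apply: IM; apply: Iv.
- by case: (Iid) => _ _ _ IM; apply: IM; apply: Iu.
Qed.

End TwoSidedIdeal.

Section RightQuantum.
Variable r : nat.
Implicit Types (f g : series r) (a b x y : 'I_r).
Local Open Scope classical_set_scope.

Definition R1_relators : set (series r) :=
  [set f | exists a x y, x != y /\
     f = biw [:: (x, a); (y, a)] - biw [:: (y, a); (x, a)]].

Definition R2_relators : set (series r) :=
  [set f | exists a b x y, x != y /\
     f = biw [:: (x, a); (y, b)]
         - (biw [:: (y, a); (x, b)] + biw [:: (y, b); (x, a)]
            - biw [:: (x, b); (y, a)])].

(* Closure for the usual topology of formal series (pointwise convergence of
   coefficients, Z discrete).  There are finitely many biwords of each length,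
   so the truncations by length give a basis of neighbourhoods. *)
Definition series_closure (I : set (series r)) : set (series r) :=
  [set f | forall n : nat, exists2 g, I g &
     forall al : biword r, (size al <= n)%N -> coef f al = coef g al].

(* In the algebra of infinite sums, the ideal generated by the commutation
   relations is understood as a closed ideal: the relations may be applied
   simultaneously in infinitely many terms of a formal sum.  With finite sums
   of terms u * relator * v only, Ferm * Bos - 1 would not lie in the ideal as
   soon as r >= 2.  Indeed, sending the biletter (1,2) to b, (2,1) to c
   and all others to 0, it would yield that  \sum_(k >= 1) (b^k c - c b^k) c^(k-1)  is a finite
   sum of terms u (bc - cb) v in Z<<b, c>>, and hence, through the upper
   triangular representation b |-> diag(b, b'), c |-> [[c, 1], [0, c']] followed
   by division by b - b' and b' := 0, that 1 / (1 - b c') is a finite sum of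
   products u(b, c) v(c'). *)
Definition commutation_ideal : set (series r) :=
  series_closure (ideal_generated (R1_relators `|` R2_relators)).

Lemma commutation_idealP : two_sided_ideal commutation_ideal.
Proof.
have [I0 IB IMl IMr] := ideal_generatedP (R1_relators `|` R2_relators).
split=> [n|u v Iu Iv n|u v Iv n|u v Iu n]; first by exists 0.
- have [[u' Iu' Eu] [v' Iv' Ev]] := (Iu n, Iv n).
  exists (u' - v'); first exact: IB.
  by move=> al le_n /=; rewrite Eu // Ev.
- have [v' Iv' Ev] := Iv n; exists (u * v'); first exact: IMl.
  move=> al le_n /=; apply: eq_bigr => i _; rewrite Ev //.
  by rewrite size_drop (leq_trans (leq_subr _ _)).
- have [u' Iu' Eu] := Iu n; exists (u' * v); first exact: IMr.
  move=> al le_n /=; apply: eq_bigr => i _; rewrite Eu //.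
  by rewrite size_take_min (leq_trans (geq_minr _ _)).
Qed.

Definition commutation_pred : {pred series r} :=
  fun f => `[< commutation_ideal f >].

Lemma commutation_predE f : reflect (commutation_ideal f) (f \in commutation_pred).
Proof. exact: asboolP. Qed.

Lemma commutation_zmod_closed : zmod_closed commutation_pred.
Proof.
have [I0 IB _ _] := commutation_idealP; split; first exact/commutation_predE.
by move=> u v /commutation_predE Iu /commutation_predE Iv; apply/commutation_predE/IB.
Qed.

HB.instance Definition _ :=
  GRing.isZmodClosed.Build (series r) commutation_pred commutation_zmod_closed.

(* The additive quotient is the library's; the library's ring quotients are
   commutative, hence the explicit product below. *)
Definition right_quantum : Type := Quotient.quot commutation_pred.

HB.instance Definition _ := GRing.Zmodule.on right_quantum.
HB.instance Definition _ :=
  EqQuotient.copy right_quantum (Quotient.quot commutation_pred).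

(* The canonical homomorphism from Z<<B>> onto the right quantum algebra. *)
Definition to_rq f : right_quantum := \pi_right_quantum f.

Lemma to_rqP f g : to_rq f = to_rq g <-> commutation_ideal (f - g).
Proof.
rewrite /to_rq; split=> [/eqP|I].
  by rewrite -[_ == _]Quotient.idealrBE => /commutation_predE.
apply/eqP; rewrite -[_ == _]Quotient.idealrBE; exact/commutation_predE.
Qed.

Definition rq_one : right_quantum := to_rq 1.
Definition rq_mul (p q : right_quantum) : right_quantum :=
  to_rq (generic_quotient.repr p * generic_quotient.repr q).

Lemma repr_rqK : cancel (@generic_quotient.repr _ right_quantum) to_rq.
Proof. exact: reprK. Qed.

Lemma to_rqD f g : to_rq (f + g) = to_rq f + to_rq g.
Proof. exact: Quotient.pi_add. Qed.

Lemma to_rqM_def f g : to_rq (f * g) = rq_mul (to_rq f) (to_rq g).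
Proof.
have [_ IB IMl IMr] := commutation_idealP.
apply/to_rqP; set f' := generic_quotient.repr _; set g' := generic_quotient.repr _.
have Ff : commutation_ideal (f - f') by apply/to_rqP; rewrite repr_rqK.
have Gg : commutation_ideal (g' - g) by apply/to_rqP; rewrite repr_rqK.
have -> : f * g - f' * g' = (f - f') * g - f' * (g' - g).
  by rewrite mulrBl mulrBr opprB addrA addrNK.
by apply: IB; [apply: IMr|apply: IMl].
Qed.

Lemma rq_mulA : associative rq_mul.
Proof.
move=> p q s; rewrite -[p]repr_rqK -[q]repr_rqK -[s]repr_rqK.
by rewrite -!to_rqM_def mulrA.
Qed.

Lemma rq_mul1 : left_id rq_one rq_mul.
Proof. by move=> p; rewrite -[p]repr_rqK -to_rqM_def mul1r. Qed.

Lemma rq_1mul : right_id rq_one rq_mul.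
Proof. by move=> p; rewrite -[p]repr_rqK -to_rqM_def mulr1. Qed.

Lemma rq_mulDl : left_distributive rq_mul +%R.
Proof.
move=> p q s; rewrite -[p]repr_rqK -[q]repr_rqK -[s]repr_rqK.
by rewrite -to_rqD -!to_rqM_def -to_rqD mulrDl.
Qed.

Lemma rq_mulDr : right_distributive rq_mul +%R.
Proof.
move=> p q s; rewrite -[p]repr_rqK -[q]repr_rqK -[s]repr_rqK.
by rewrite -to_rqD -!to_rqM_def -to_rqD mulrDr.
Qed.

HB.instance Definition _ := GRing.Zmodule_isPzRing.Build right_quantum
  rq_mulA rq_mul1 rq_1mul rq_mulDl rq_mulDr.

Lemma to_rqM f g : to_rq (f * g) = to_rq f * to_rq g.
Proof. exact: to_rqM_def. Qed.

Lemma to_rq1 : to_rq 1 = 1. Proof. by []. Qed.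

End RightQuantum.

Section BosFerm.
Variable r : nat.

Definition sort_word (w : seq 'I_r) : seq 'I_r :=
  sort (fun i j : 'I_r => (i <= j)%N) w.

(* The infinite sum over all words w of the biwords (sort w / w).  These biwords
   are pairwise distinct, as w is the bottom word, so every coefficient is 0 or
   1: it is 1 exactly on the biwords of that form. *)
Definition Bos : series r :=
  Series (fun al => (top al == sort_word (bottom al))%:R).

Lemma BosP (al : biword r) :
  reflect (exists w, al = zip (sort_word w) w) (top al == sort_word (bottom al)).
Proof.
apply: (iffP eqP) => [Eal|[w ->]].
  by exists (bottom al); rewrite -Eal /top /bottom zip_unzip.
by rewrite /top /bottom unzip1_zip ?unzip2_zip // size_sort.
Qed.

Definition inv_on (J : {set 'I_r}) (s : {perm 'I_r}) : nat :=
  #|[set p : 'I_r * 'I_r |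
      [&& p.1 \in J, p.2 \in J, (p.1 < p.2)%N & (s p.2 < s p.1)%N]]|.

(* The permutations of J are those of the whole alphabet with support in J;
   [enum J] lists J in increasing order. *)
Definition Ferm : series r :=
  \sum_(J : {set 'I_r}) (-1) ^+ #|J| *
    \sum_(s : {perm 'I_r} | perm_on J s)
      (-1) ^+ inv_on J s * biw [seq (s i, i) | i <- enum J].

End BosFerm.

(* Main.v *)
(* The relations say exactly that the forms [\sum_a X x a t_a], with commuting
   t_a, commute with each other, and that the forms [\sum_x theta_x X x a], with
   anticommuting theta_x, anticommute and square to 0.  Hence the matrix X acts on
   the symmetric powers S^m V (as quotients of tensor powers) and on the exterior
   powers of V (as subspaces), Bos and Ferm are the sums of the traces of these
   actions, with signs for Ferm, and the degree n part of Ferm * Bos is the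
   supertrace of X on the Koszul complex [\Lambda^k V \otimes S^(n-k) V].  The
   Koszul differential commutes with X and, for n > 0, has an integral contraction
   moving one chosen letter x from the symmetric to the exterior part (x depends
   only on the content, which the differential preserves); so the supertrace
   telescopes to 0. *)
Require Import Defs.
From HB Require Import structures.
From mathcomp Require Import all_boot all_order all_algebra all_fingroup.
Local Open Scope ring_scope.

Set Implicit Arguments.
Unset Strict Implicit.
Unset Printing Implicit Defensive.

Import GRing.Theory.

(** The pairs [(i, j)] and [(j, i)] cancel. The diagonal needs its own hypothesis because [V] may
    have 2-torsion, so [D i i = - D i i] does not make it vanish. *)
Lemma sum_alternating (r : nat) (V : zmodType) (D : 'I_r -> 'I_r -> V) :
  (forall i, D i i = 0) -> (forall i j, D i j = - D j i) ->
  \sum_i \sum_j D i j = 0.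
Proof.
move=> D0 DN; rewrite pair_bigA /=.
rewrite (bigID (fun p : 'I_r * 'I_r => (p.1 < p.2)%N)) /= addrC.
rewrite (bigID (fun p : 'I_r * 'I_r => p.1 == p.2)) /=.
rewrite big1 ?add0r => [|[i j] /= /andP[_ /eqP->] //].
rewrite (reindex_inj (h := fun p : 'I_r * 'I_r => (p.2, p.1))) /=; last first.
  by move=> [a b] [c d] [-> ->].
rewrite (eq_bigl (fun p : 'I_r * 'I_r => (p.1 < p.2)%N)) => [|[i j] /=].
  by rewrite -big_split big1 // => [[i j]] _ /=; rewrite DN addNr.
by rewrite -leqNgt ltn_neqAle andbC eq_sym.
Qed.

(** * Reordering signs and increasing enumerations of subsets *)

Section Signs.
Variable r : nat.
Implicit Types (P J : {set 'I_r}) (x y z : 'I_r).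

(** For [z] in [P], [(-1) ^+ above P z] is the sign of sorting theta_z, placed to the right of the
    increasing product over [P :\ z], into that product. *)
Definition above P z : nat := #|[set u in P | (z < u)%N]|.

Lemma aboveU1 P z u : z \notin P -> above (z |: P) u = ((u < z) + above P u)%N.
Proof.
move=> zP; rewrite /above; case uz: (u < z)%N.
  have -> : [set v in z |: P | (u < v)%N] = z |: [set v in P | (u < v)%N].
    by apply/setP=> v; rewrite !inE; case: eqP => //= ->; rewrite uz.
  by rewrite cardsU1 inE (negbTE zP).
congr #|pred_of_set _|; apply/setP=> v; rewrite !inE.
by case: eqP => //= ->; rewrite uz andbF.
Qed.

Lemma aboveU1_self P z : z \notin P -> above (z |: P) z = above P z.
Proof. by move/aboveU1->; rewrite ltnn. Qed.

(** Exactly one of [z < u] and [u < z] holds, and the contributions of the other elements of [P]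
    agree. This is the anticommutation of theta_z and theta_u. *)
Lemma aboveD1_swap P z u : z \in P -> u \in P -> z != u ->
  odd (above P z + above (P :\ z) u) = ~~ odd (above P u + above (P :\ u) z).
Proof.
move=> zP uP zu; set Q := P :\ z :\ u.
have zQ : z \notin u |: Q by rewrite !inE eqxx (negbTE zu) andbF.
have uQ : u \notin z |: Q by rewrite !inE eqxx eq_sym (negbTE zu).
have z1 : z \notin Q by rewrite !inE eqxx andbF.
have u1 : u \notin Q by rewrite !inE eqxx.
have eP : P = z |: (u |: Q) by rewrite setD1K ?setD1K // !inE eq_sym zu.
have ez : P :\ z = u |: Q by rewrite setD1K // !inE eq_sym zu.
have eu : P :\ u = z |: Q by rewrite eP setUCA setU1K.
rewrite ez eu !aboveU1_self // {1}eP aboveU1_self // aboveU1 //.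
rewrite eP setUCA aboveU1_self // aboveU1 //.
rewrite !oddD !oddb.
have -> : (u < z)%N = ~~ (z < u)%N.
  by rewrite -leqNgt [RHS]leq_eqVlt -[_ == _ :> nat]/(u == z) eq_sym (negbTE zu).
by case: (z < u)%N; case: (odd (above Q z)); case: (odd (above Q u)).
Qed.

Lemma enum_set_pairwise J : pairwise (fun i j : 'I_r => (i < j)%N) (enum J).
Proof.
rewrite -sorted_pairwise; last by move=> j i k; apply: ltn_trans.
rewrite {1}/enum_mem -enumT sorted_filter //; first by move=> j i k; apply: ltn_trans.
by rewrite -(sorted_map (f := val) (e' := ltn)) val_enum_ord iota_ltn_sorted.
Qed.

Lemma enum_set_sortedP J w : pairwise (fun i j : 'I_r => (i < j)%N) w ->
  w =i J -> w = enum J.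
Proof.
move=> sw e; apply: (irr_sorted_eq (leT := fun i j : 'I_r => (i < j)%N)).
- by move=> j i k; apply: ltn_trans.
- by move=> i; rewrite ltnn.
- by rewrite sorted_pairwise // => j i k; apply: ltn_trans.
- by rewrite sorted_pairwise ?enum_set_pairwise // => j i k; apply: ltn_trans.
by move=> i; rewrite e mem_enum.
Qed.

Lemma enum_split J y : y \notin J ->
  enum J = [seq u : 'I_r <- enum J | (u < y)%N] ++ [seq u : 'I_r <- enum J | (y < u)%N].
Proof.
move=> yJ; apply/esym/enum_set_sortedP.
  rewrite pairwise_cat; apply/and3P; split; try by apply/pairwise_filter/enum_set_pairwise.
  by apply/allrelP=> i j; rewrite !mem_filter => /andP[iy _] /andP[yj _]; apply: ltn_trans yj.
move=> i; have := mem_enum J i; move: (enum J) => e ie.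
rewrite mem_cat !mem_filter ie -andb_orl -neq_ltn.
by case: (boolP (i \in J)) => iJ; rewrite ?andbF // andbT; apply: contraNneq yJ => /val_inj<-.
Qed.

Lemma enum_setU1 J y : y \notin J ->
  enum (y |: J) =
  [seq u : 'I_r <- enum J | (u < y)%N] ++ y :: [seq u : 'I_r <- enum J | (y < u)%N].
Proof.
move=> yJ; apply/esym/enum_set_sortedP.
  rewrite pairwise_cat /= filter_all.
  apply/and3P; split; try by apply/pairwise_filter/enum_set_pairwise.
  apply/allrelP=> i j; rewrite inE !mem_filter => /andP[iy _] /orP[/eqP->//|/andP[yj _]].
  exact: ltn_trans yj.
move=> i; have := mem_enum J i; move: (enum J) => e ie.
rewrite mem_cat !inE !mem_filter ie orbCA -andb_orl -neq_ltn.
by rewrite -[_ != _ :> nat]/(i != y); case: (i == y).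
Qed.

Lemma size_enum_above J y : size [seq u : 'I_r <- enum J | (y < u)%N] = above J y.
Proof.
rewrite /above cardE; congr size; apply: enum_set_sortedP.
  exact/pairwise_filter/enum_set_pairwise.
by move=> i; rewrite mem_filter mem_enum inE andbC.
Qed.

End Signs.

(** * Contents of words, the exponent vectors of monomials *)

Section Contents.
Variable r : nat.
Implicit Types (c q : {ffun 'I_r -> nat}) (J : {set 'I_r}).

Definition supp c := [set a | (0 < c a)%N].
(** The subtraction is truncated; it is the true difference when [J \subset supp c], a condition
    that the sums over [J] below impose. *)
Definition minus c J : {ffun 'I_r -> nat} := [ffun a => (c a - (a \in J))%N].
Definition lower q y : {ffun 'I_r -> nat} := [ffun a => (q a - (a == y))%N].
Definition word q := flatten [seq nseq (q a) a | a <- enum 'I_r].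

Lemma count_word q a : count_mem a (word q) = q a.
Proof.
rewrite count_flatten -map_comp sumnE big_map big_enum /= (bigD1 a) //=.
rewrite count_nseq /= eqxx mul1n big1 ?addn0 // => b ba.
by rewrite count_nseq /= (negbTE ba).
Qed.

Lemma perm_word q w : (forall a, count_mem a w = q a) -> perm_eq w (word q).
Proof. by move=> e; apply/allP=> a _ /=; rewrite e count_word. Qed.

Lemma perm_cons_word_minus c J x : x \notin J -> x \in supp c ->
  perm_eq (x :: word (minus c (x |: J))) (word (minus c J)).
Proof.
rewrite inE => xJ cx; apply: perm_word => a /=; rewrite count_word !ffunE !inE.
by case: eqVneq => [<-|]; rewrite ?(negbTE xJ) //= subn0 addnC subnK.
Qed.

Lemma minus_lower c J y : y \notin J -> lower (minus c J) y = minus c (y |: J).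
Proof.
move=> yJ; apply/ffunP=> a; rewrite !ffunE !inE -subnDA.
by case: eqP => [->|]; rewrite ?(negbTE yJ) //= addn0.
Qed.

End Contents.

(** * Words, inversions and permutations of a subset *)

Section Words.
Variable r : nat.
Implicit Types (P J : {set 'I_r}) (v w : seq 'I_r) (s : {perm 'I_r}).

Fixpoint invw v : nat :=
  if v is x :: v' then (count (fun u : 'I_r => (u < x)%N) v' + invw v')%N else 0%N.

Lemma invw_rcons v z :
  invw (rcons v z) = (invw v + count (fun u : 'I_r => (z < u)%N) v)%N.
Proof.
elim: v => //= x v ->; rewrite -cats1 count_cat /= addn0.
by rewrite -!addnA; congr (_ + _)%N; rewrite addnCA.
Qed.

(** Sorting the arrangements by their last letter matches the recursion of [ext], which multiplies
    on the right. *)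
Lemma permutations_rcons P : (0 < #|P|)%N ->
  perm_eq (permutations (enum P))
    [seq rcons v z | z <- enum P, v <- permutations (enum (P :\ z))].
Proof.
move=> P0; apply: uniq_perm; first exact: permutations_uniq.
  apply: allpairs_uniq_dep; first exact: enum_uniq.
    by move=> z _; apply: permutations_uniq.
  by move=> [z v] [z' v'] _ _ /= /rcons_inj[-> ->].
have permE z v : z \in P -> perm_eq (rcons v z) (enum P) = perm_eq v (enum (P :\ z)).
  move=> zP; rewrite perm_rcons -[RHS](perm_cons z).
  suff /permPr-> : perm_eq (enum P) (z :: enum (P :\ z)) by [].
  apply: uniq_perm; rewrite /= ?enum_uniq ?mem_enum ?inE ?eqxx // => u.
  by rewrite inE !mem_enum !inE; case: eqP => // ->.
move=> t; rewrite mem_permutations; case/lastP: t => [|v z].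
  have /negbTE-> : ~~ perm_eq [::] (enum P).
    by apply: contraTN P0 => /perm_size/eqP; rewrite eq_sym -cardE -leqn0 leqNgt.
  by apply/esym/negbTE/allpairsPdep=> [[z [[|? ?] [_ _]]]].
apply/idP/allpairsPdep => [e|[z' [v' [zP vP /rcons_inj[-> ->]]]]]; last first.
  by move: zP vP; rewrite mem_enum mem_permutations => zP; rewrite permE.
have zP : z \in P by rewrite -mem_enum -(perm_mem e) mem_rcons mem_head.
by exists z, v; rewrite mem_enum mem_permutations -permE.
Qed.

Lemma inv_onE J s : inv_on J s = invw [seq s i | i <- enum J].
Proof.
rewrite /inv_on -sum1_card.
transitivity (\sum_(i <- enum J) \sum_(j <- enum J) ((i < j) && (s j < s i) : nat))%N.
  rewrite big_enum; under [RHS]eq_bigr do rewrite big_enum.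
  rewrite pair_big /= [RHS]big_mkcond [LHS]big_mkcond; apply: eq_bigr => [[i j]] _.
  by rewrite inE /= andbA; case: ifP; case: ((i \in J) && (j \in J)) => //= ->.
elim: (enum J) (enum_set_pairwise J) => [|x l IH] /=; first by rewrite big_nil.
case/andP=> /allP xl /IH{}IH; rewrite big_cons big_cons ltnn add0n -IH; congr (_ + _)%N.
  rewrite count_map -sum1_count [RHS]big_mkcond /=; apply: eq_big_seq => j /xl ->.
  by case: ifP.
apply: eq_big_seq => j /xl xj; rewrite big_cons.
by rewrite ltnNge (ltnW xj).
Qed.

Lemma permutations_perm_on J :
  perm_eq (permutations (enum J)) [seq [seq s i | i <- enum J] | s <- enum (perm_on J)].
Proof.
set l := [seq _ | s <- _].
have ul : uniq l.
  rewrite map_inj_in_uniq ?enum_uniq // => s s'.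
  rewrite !mem_enum => sJ sJ' /eq_in_map e; apply/permP=> i.
  case: (boolP (i \in J)) => iJ; first by apply: e; rewrite mem_enum.
  by rewrite (out_perm sJ iJ) (out_perm sJ' iJ).
have sl : {subset l <= permutations (enum J)}.
  move=> _ /mapP[s sJ ->]; rewrite mem_enum in sJ; rewrite mem_permutations.
  apply: uniq_perm; rewrite ?map_inj_uniq ?enum_uniq //; first exact: perm_inj.
  move=> i; rewrite mem_enum; apply/mapP/idP => [[j + ->]|iJ].
    by rewrite mem_enum perm_closed.
  by exists (s^-1 i)%g; rewrite ?permKV // mem_enum -(perm_closed _ sJ) permKV.
(* Both lists are duplicate-free of length [#|J|] factorial, so the inclusion is an equality. *)
have [] := uniq_min_size ul sl.
  by rewrite size_permutations ?enum_uniq // size_map -!cardE card_perm.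
by move=> _ e; apply: uniq_perm; rewrite ?permutations_uniq // => t; rewrite e.
Qed.

Fixpoint words n : seq (seq 'I_r) :=
  if n is n'.+1 then [seq x :: w | x <- enum 'I_r, w <- words n'] else [:: [::]].

Lemma words_uniq n : uniq (words n).
Proof.
elim: n => //= n IH; apply: allpairs_uniq; rewrite ?enum_uniq //.
by move=> [x v] [y w] _ _ [-> ->].
Qed.

Lemma mem_words n w : (w \in words n) = (size w == n).
Proof.
elim: n w => [|n IH] [|x w] //=; first by apply/negbTE/allpairsP=> [[[y v] [_ _]]].
rewrite eqSS -IH; apply/allpairsP/idP => [[[y v] /= [_ vn [_ ->]]] //|wn].
by exists (x, w); rewrite mem_enum.
Qed.

Definition content w : {ffun 'I_r -> nat} := [ffun a => count_mem a w].

Lemma perm_sort_wordP v w : reflect (sort_word v = sort_word w) (perm_eq v w).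
Proof.
apply: perm_sortP => [i j|j i k|i j]; [exact: leq_total|exact: leq_trans|].
by move=> /anti_leq/val_inj.
Qed.

Lemma size_word (q : {ffun 'I_r -> nat}) : size (word q) = (\sum_a q a)%N.
Proof.
rewrite size_flatten /shape -map_comp sumnE big_map big_enum /=.
by apply: eq_bigr => a _; rewrite size_nseq.
Qed.

Lemma size_content w : size w = (\sum_a content w a)%N.
Proof.
by rewrite -size_word; apply/perm_size/perm_word => a; rewrite ffunE.
Qed.

Lemma sum_minus (c : {ffun 'I_r -> nat}) J : J \subset supp c ->
  (#|J| + \sum_a minus c J a)%N = (\sum_a c a)%N.
Proof.
move=> sJ; rewrite -sum1_card big_mkcond -big_split; apply: eq_bigr => a _ /=.
rewrite ffunE; case: (boolP (a \in J)) => //= [aJ|_]; last by rewrite subn0.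
by have := subsetP sJ a aJ; rewrite inE => /subnKC.
Qed.

(** Contents of total [d] have entries at most [d]; bounding them gives a finite type to sum
    over. *)
Definition natfun d (c : {ffun 'I_r -> 'I_d}) : {ffun 'I_r -> nat} := [ffun a => val (c a)].

(** The only possible [c] is the indicator of [J] plus the content of [w]. Summing over [c] thus
    counts each pair [(J, w)] of total degree [d] once, which splits that degree by content. *)
Lemma content_minusE d J w : size w = (d - #|J|)%N -> (#|J| <= d)%N ->
  forall c : {ffun 'I_r -> 'I_d.+1},
  [&& (\sum_a c a == d)%N, J \subset supp (natfun c) & content w == minus (natfun c) J]
  = (c == [ffun a => inord ((a \in J) + count_mem a w)]).
Proof.
move=> sw Jd c.
have tot : (\sum_a ((a \in J) + count_mem a w) = d)%N.
  rewrite big_split /= -[RHS](subnKC Jd) -sw [in RHS]size_content; congr (_ + _)%N.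
    by rewrite -sum1_card [RHS]big_mkcond /=; apply: eq_bigr => a _; case: ifP.
  by apply: eq_bigr => a _; rewrite ffunE.
have bound a : ((a \in J) + count_mem a w < d.+1)%N.
  by rewrite ltnS -[leqRHS]tot (bigD1 a) //= leq_addr.
apply/and3P/eqP => [[_ /subsetP sJ /eqP/ffunP e]|->].
  apply/ffunP=> a; apply: val_inj; rewrite ffunE /= inordK //.
  move: (e a) (sJ a); rewrite !ffunE inE ffunE => ->.
  by case: (a \in J) => [/(_ isT)/subnKC|_]; rewrite ?subn0.
have E a : natfun [ffun a => inord ((a \in J) + count_mem a w) : 'I_d.+1] a =
    ((a \in J) + count_mem a w)%N by rewrite !ffunE /= inordK.
split; first by rewrite -[eqbRHS]tot; apply/eqP; apply: eq_bigr => a _; rewrite -E [RHS]ffunE.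
  by apply/subsetP=> a aJ; rewrite inE E aJ.
by apply/eqP/ffunP=> a; rewrite [RHS]ffunE E ffunE addKn.
Qed.

End Words.

(** * Exterior and symmetric powers of a matrix with the right quantum relations *)

Section Algebra.
Variables (r : nat) (A : pzRingType) (X : 'I_r -> 'I_r -> A).
Hypothesis X_same_bottom : forall x y a, X x a * X y a = X y a * X x a.
Hypothesis X_exchange : forall x y a b,
  X x a * X y b + X x b * X y a = X y a * X x b + X y b * X x a.

Implicit Types (P J : {set 'I_r}) (w v : seq 'I_r) (f : {ffun {set 'I_r} -> A}).

(* Right multiplication by the odd form [\sum_z theta_z X z y]; [f P] stands for
   the coefficient of the increasing product of the theta_z, z in P. *)
Definition ext f y : {ffun {set 'I_r} -> A} :=
  [ffun P : {set 'I_r} => \sum_(z in P) (-1) ^+ above P z * (f (P :\ z) * X z y)].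

Definition ext0 : {ffun {set 'I_r} -> A} := [ffun P : {set 'I_r} => (P == set0)%:R].
Definition extw w := foldl ext ext0 w.

Lemma extN f y : ext (- f) y = - ext f y.
Proof.
apply/ffunP=> P; rewrite !ffunE -sumrN.
by apply: eq_bigr => z _; rewrite !ffunE mulNr mulrN.
Qed.

Lemma ext_0 y : ext 0 y = 0.
Proof.
apply/ffunP=> P; rewrite !ffunE big1 // => z _.
by rewrite ffunE mul0r mulr0.
Qed.

Lemma extE2 f a b P : ext (ext f a) b P = \sum_z \sum_u
  if [&& z \in P, u \in P & z != u] then
    (-1) ^+ (above P z + above (P :\ z) u) *
      (f (P :\ z :\ u) * (X u a * X z b)) else 0.
Proof.
rewrite ffunE big_mkcond /=; apply: eq_bigr => z _.
case: (boolP (z \in P)) => zP /=; last by rewrite big1.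
rewrite ffunE mulr_suml mulr_sumr big_mkcond /=; apply: eq_bigr => u _.
rewrite !inE eq_sym andbC; case: ifP => // _.
by rewrite exprD !mulrA.
Qed.

(** Exchanging the two removed letters flips the sign by [aboveD1_swap], and [X_exchange] equates
    the two resulting sums of products. *)
Lemma ext_anticomm f a b : ext (ext f a) b = - ext (ext f b) a.
Proof.
apply/eqP; rewrite -addr_eq0; apply/eqP/ffunP=> P.
rewrite [LHS]ffunE !extE2 [RHS]ffunE -big_split /=.
under eq_bigr do rewrite -big_split /=.
apply: sum_alternating => [i|i j]; first by rewrite eqxx !andbF addr0.
rewrite andbCA [j == i]eq_sym; case: ifP => [/and3P[jP iP ij]|_]; last by rewrite addr0 oppr0.
rewrite -signr_odd aboveD1_swap // -[in RHS]signr_odd.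
have -> : P :\ i :\ j = P :\ j :\ i by apply/setP=> k; rewrite !inE andbCA.
case: (odd _) => /=; rewrite ?expr1 ?expr0 !mul1r ?mulN1r -?opprD ?opprK -!mulrDr;
  by rewrite [X j a * _ + _]addrC X_exchange ?[_ + X j a * _]addrC // addrC.
Qed.

(** [ext_anticomm] only shows that twice the square vanishes; [X_same_bottom] gives the square
    itself. *)
Lemma ext_sq f a : ext (ext f a) a = 0.
Proof.
apply/ffunP=> P; rewrite extE2 ffunE.
apply: sum_alternating => [i|i j]; first by rewrite eqxx !andbF.
rewrite andbCA [j == i]eq_sym; case: ifP => [/and3P[jP iP ij]|_]; last by rewrite oppr0.
rewrite -signr_odd aboveD1_swap // -[in RHS]signr_odd X_same_bottom.
have -> : P :\ i :\ j = P :\ j :\ i by apply/setP=> k; rewrite !inE andbCA.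
by case: (odd _) => /=; rewrite ?expr1 ?expr0 !mul1r ?mulN1r ?opprK.
Qed.

Lemma extw_rcons w y P : extw (rcons w y) P =
  \sum_(z in P) (-1) ^+ above P z * (extw w (P :\ z) * X z y).
Proof. by rewrite /extw foldl_rcons ffunE. Qed.

(** One application of [ext_anticomm] for each letter of [w2] that [y] passes. *)
Lemma extw_move w1 w2 y P :
  extw (w1 ++ rcons w2 y) P = (-1) ^+ size w2 * extw (w1 ++ y :: w2) P.
Proof.
elim: w2 w1 => [|x w2 IH] w1 /=; first by rewrite expr0 mul1r.
rewrite -cat_rcons IH cat_rcons exprS mulN1r mulNr -mulrN; congr (_ * _).
suff -> : extw (w1 ++ [:: x, y & w2]) = - extw (w1 ++ [:: y, x & w2]) by rewrite ffunE.
rewrite /extw !foldl_cat /= ext_anticomm.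
by elim: w2 {IH} (ext _ _) => //= z w IH g; rewrite extN IH.
Qed.

Lemma extw_rcons_mem w y : y \in w -> extw (rcons w y) = 0.
Proof.
case/splitPr=> w1 w2; apply/ffunP=> P.
rewrite rcons_cat -cat_rcons extw_move cat_rcons /extw foldl_cat /= ext_sq.
suff -> : foldl ext 0 w2 = 0 by rewrite ffunE mulr0.
by elim: w2 => //= z v IH; rewrite ext_0.
Qed.

Lemma extw_rcons_enum J y P : y \notin J ->
  extw (rcons (enum J) y) P = (-1) ^+ above J y * extw (enum (y |: J)) P.
Proof.
by move=> yJ; rewrite enum_setU1 // {1}(enum_split yJ) rcons_cat extw_move size_enum_above.
Qed.

(* [symw p q] is the coefficient of the monomial t^q in the product over the
   letters z of p of the commuting forms [\sum_y X z y t_y]. *)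
Definition symw (p : seq 'I_r) : {ffun 'I_r -> nat} -> A :=
  foldr (fun z g (q : {ffun 'I_r -> nat}) => \sum_(y | (0 < q y)%N) X z y * g (lower q y))
        (fun q : {ffun 'I_r -> nat} => (q == [ffun=> 0%N])%:R) p.

Arguments symw : simpl never.

Lemma symw_cons z p q :
  symw (z :: p) q = \sum_(y | (0 < q y)%N) X z y * symw p (lower q y).
Proof. by []. Qed.

(** In the difference of the two sides the terms [(i, j)] and [(j, i)] cancel by [X_exchange], and
    the diagonal ones vanish by [X_same_bottom]. *)
Lemma symw_swap z u p q : symw (z :: u :: p) q = symw (u :: z :: p) q.
Proof.
pose D z u i j := if (0 < q i)%N && (0 < lower q i j)%N
  then X z i * X u j * symw p (lower (lower q i) j) else 0.
have E z' u' : symw (z' :: u' :: p) q = \sum_i \sum_j D z' u' i j.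
  rewrite symw_cons big_mkcond; apply: eq_bigr => i _; rewrite /D.
  case: ifP => _ /=; last by rewrite big1.
  rewrite symw_cons mulr_sumr big_mkcond; apply: eq_bigr => j _.
  by rewrite mulrA.
apply/eqP; rewrite !E -subr_eq0 -sumrB; apply/eqP.
under eq_bigr do rewrite -sumrB.
have lowC i j : lower (lower q i) j = lower (lower q j) i.
  by apply/ffunP=> a; rewrite !ffunE subnAC.
have condC i j : (0 < q i)%N && (0 < lower q i j)%N = (0 < q j)%N && (0 < lower q j i)%N.
  rewrite !ffunE [i == j]eq_sym; case: eqP => [->//|_].
  by rewrite !subn0 andbC.
apply: sum_alternating => [i|i j]; rewrite /D.
  case: ifP => _; last by rewrite subrr.
  by rewrite (X_same_bottom u z) subrr.
rewrite condC lowC; case: ifP => _; last by rewrite subrr oppr0.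
rewrite -!mulrBl -[RHS]mulNr; congr (_ * _); rewrite opprB.
apply/eqP; rewrite subr_eq addrAC eq_sym subr_eq; apply/eqP.
by rewrite [RHS]addrC X_exchange addrC.
Qed.

(** The first letter of [p] is located in [p'] and carried to its front by adjacent swaps. *)
Lemma symw_perm p p' : perm_eq p p' -> symw p =1 symw p'.
Proof.
elim: p p' => [|x p IH] p'; first by rewrite perm_sym => /perm_nilP->.
move=> e; have xp' : x \in p' by rewrite -(perm_mem e) mem_head.
case/splitPr: xp' e => w1 w2; rewrite perm_sym perm_catC /= perm_cons => e q.
have {}e : perm_eq p (w1 ++ w2) by rewrite perm_sym perm_catC.
have -> : symw (w1 ++ x :: w2) q = symw (x :: w1 ++ w2) q.
  elim: w1 q {e} => //= z w1 IHw q.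
  rewrite -[RHS]/(symw [:: x, z & w1 ++ w2] q) symw_swap.
  by rewrite !(symw_cons z); apply: eq_bigr => y _; rewrite IHw.
by rewrite !symw_cons; apply: eq_bigr => y _; rewrite (IH _ e).
Qed.

(* The Koszul differential commutes with the action of X. *)
Lemma ext_sym_naturality P w p (q : {ffun 'I_r -> nat}) :
  \sum_(y | (0 < q y)%N) extw (rcons w y) P * symw p (lower q y) =
  \sum_(z in P) (-1) ^+ above P z * (extw w (P :\ z) * symw (z :: p) q).
Proof.
under eq_bigr do rewrite extw_rcons mulr_suml.
rewrite exchange_big /=; apply: eq_bigr => z _.
rewrite symw_cons !mulr_sumr; apply: eq_bigr => y _.
by rewrite !mulrA.
Qed.

(** * The supertrace on the Koszul complex in a fixed content *)

Section Koszul.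
Variables (c : {ffun 'I_r -> nat}) (x : 'I_r).
Hypothesis cx : (0 < c x)%N.

(** [term J] is the diagonal entry of X at [(J, c - J)]. For [y] outside [J], [offdiag J y] is the
    entry between the basis vectors given by [x |: J] and [y |: J]. *)
Let term J := extw (enum J) J * symw (word (minus c J)) (minus c J).
Let offdiag J y :=
  extw (enum (y |: J)) (x |: J) * symw (word (minus c (x |: J))) (minus c (y |: J)).

(* This is the naturality identity at the matrix entry from the image of the
   contraction on (J, c - J), namely (x |: J, c - J - x), to (J, c - J): the two
   diagonal terms come from y = x and z = x. *)
Lemma koszul_step J : x \notin J -> J \subset supp c ->
  (-1) ^+ above J x * (term J - term (x |: J)) =
  \sum_(y | (y \notin x |: J) && (y \in supp c)) (-1) ^+ above J y * offdiag J y
  - \sum_(z in J) (-1) ^+ above (x |: J) z * offdiag (J :\ z) z.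
Proof.
move=> xJ sJ.
have := ext_sym_naturality (x |: J) (enum J) (word (minus c (x |: J))) (minus c J).
rewrite big_setU1 //= setU1K // aboveU1_self //.
have -> : symw (x :: word (minus c (x |: J))) (minus c J) =
    symw (word (minus c J)) (minus c J).
  by apply: symw_perm; apply: perm_cons_word_minus; rewrite ?inE.
(* A letter [y] of [J] would repeat an odd form, so it contributes 0. *)
rewrite (bigID [in J]) /= big1 ?add0r => [|y /andP[_ yJ]]; last first.
  by rewrite extw_rcons_mem ?mem_enum // ffunE mul0r.
have condE y : (0 < minus c J y)%N && (y \notin J) = (y \notin J) && (y \in supp c).
  by rewrite ffunE inE andbC; case: (boolP (y \in J)) => //= _; rewrite subn0.
rewrite (eq_bigl _ _ condE) (bigD1 x) /=; last by rewrite xJ inE.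
rewrite extw_rcons_enum // minus_lower // => e.
rewrite -mulrA in e.
rewrite mulrBr; apply/eqP; rewrite subr_eq addrAC eq_sym subr_eq addrC; apply/eqP.
transitivity ((-1) ^+ above J x * term (x |: J) +
    \sum_(i | (i \notin J) && (i \in supp c) && (i != x))
       extw (rcons (enum J) i) (x |: J) *
       symw (word (minus c (x |: J))) (lower (minus c J) i)).
  congr (_ + _); apply: eq_big => [y|y].
    by rewrite !inE negb_or; case: (y == x); case: (y \in J); case: (0 < c y)%N.
  rewrite !inE negb_or => /andP[/andP[_ yJ] _].
  by rewrite /offdiag extw_rcons_enum // minus_lower // mulrA.
rewrite e; congr (_ + _); apply: eq_bigr => z zJ.
have zx : z != x by apply: contraNneq xJ => <-.
rewrite /offdiag setD1K //; congr (_ * (extw _ _ * _)).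
  by apply/setP=> u; rewrite !inE; case: (eqVneq u x) => //= ->; rewrite eq_sym zx.
(* Removing [z] from [x |: J] returns one letter [z] to the symmetric part. *)
apply: symw_perm; rewrite -[in minus c (x |: J)](setD1K zJ) setUCA.
apply: perm_cons_word_minus; last exact: (subsetP sJ).
by rewrite !inE (negbTE zx) eqxx.
Qed.

(** Each [J] avoiding [x] is paired with [x |: J], of opposite sign; [koszul_step] turns the pair
    into off-diagonal entries. *)
Lemma koszul_supertrace :
  \sum_(J : {set 'I_r} | J \subset supp c) (-1) ^+ #|J| * term J = 0.
Proof.
have xs : x \in supp c by rewrite inE.
rewrite (bigID (fun J => x \in J)) /= addrC.
rewrite [X in _ + X](reindex_onto (fun J => x |: J) (fun J => J :\ x)) /=; last first.
  by move=> J /andP[_ xJ]; rewrite setD1K.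
have cond J : [&& x |: J \subset supp c, x \in x |: J & (x |: J) :\ x == J] =
    (J \subset supp c) && (x \notin J).
  rewrite subUset sub1set xs setU11 /=; congr (_ && _).
  apply/eqP/idP => [<-|xJ]; last exact: setU1K.
  by rewrite !inE eqxx.
rewrite [X in _ + X](eq_bigl (fun J => (J \subset supp c) && (x \notin J))); last first.
  by move=> J; rewrite -cond andbA.
rewrite -big_split /=.
transitivity (\sum_(J : {set 'I_r} | (J \subset supp c) && (x \notin J))
  (\sum_(y | (y \notin x |: J) && (y \in supp c))
      (-1) ^+ (#|J| + above J x + above J y) * offdiag J y
   - \sum_(z in J) (-1) ^+ (#|J| + above J x + above (x |: J) z) * offdiag (J :\ z) z)).
  apply: eq_bigr => J /andP[sJ xJ].
  rewrite cardsU1 xJ exprS mulN1r mulNr -mulrBr.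
  (* The sign [(-1) ^+ above J x] is inserted twice, so that one copy meets [koszul_step]. *)
  rewrite -[term J - _](signrMK (above J x)) koszul_step // mulrA -exprD.
  rewrite mulrBr !mulr_sumr.
  by congr (_ - _); apply: eq_bigr => z _; rewrite [in RHS]exprD mulrA.
(* The off-diagonal terms cancel along (J, y) <-> (y |: J, y). *)
rewrite sumrB; apply/eqP; rewrite subr_eq0; apply/eqP.
rewrite !pair_big_dep /= [RHS](reindex_onto (fun p : {set 'I_r} * 'I_r => (p.2 |: p.1, p.2))
  (fun p => (p.1 :\ p.2, p.2))) /=; last first.
  by move=> [J z] /= /andP[_ zJ]; rewrite setD1K.
apply: eq_big => [[J y]|[J y]] /=.
  rewrite -pair_eqE /= eqxx andbT setU11 andbT subUset sub1set !inE !negb_or.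
  apply/idP/idP.
    move=> /andP[/andP[-> xJ] /andP[/andP[yx yJ] ->]] /=.
    by rewrite xJ eq_sym yx /= setU1K.
  move=> /andP[/andP[/andP[-> ->] /andP[xy ->]] /eqP<-].
  by rewrite !inE eqxx eq_sym xy.
rewrite !inE negb_or => /andP[/andP[sJ xJ] /andP[/andP[yx yJ] ys]].
rewrite setU1K //; congr (_ * _).
(* Adding [y] to [J] flips the parity of the cardinality, and exactly one of [x < y] and [y < x]
   flips it back. *)
rewrite setUCA aboveU1_self; last by rewrite !inE negb_or yx.
rewrite cardsU1 yJ !aboveU1 //.
rewrite -[LHS]signr_odd -[RHS]signr_odd; congr (_ ^+ nat_of_bool _).
have yxE : (y < x)%N = ~~ (x < y)%N.
  by rewrite -leqNgt [RHS]leq_eqVlt -[_ == _ :> nat]/(y == x) (negbTE yx).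
rewrite !oddD !oddb yxE.
by case: (x < y)%N; case: odd; case: odd; case: odd.
Qed.

End Koszul.

(** * Expansion of the two actions over permutations and words *)

Definition Xw (v w : seq 'I_r) : A := \prod_(p <- zip v w) X p.1 p.2.

(** Induction on the last letter: the inversions that a final [z] creates are with the elements of
    [P] above it, which is the sign exponent in [ext]. *)
Lemma extw_permutations w P : size w = #|P| ->
  extw w P = \sum_(v <- permutations (enum P)) (-1) ^+ invw v * Xw v w.
Proof.
elim/last_ind: w P => [|w y IH] P /=.
  move/esym/eqP; rewrite cards_eq0 => /eqP->.
  by rewrite enum_set0 big_seq1 /Xw big_nil mulr1 ffunE eqxx.
rewrite size_rcons => sP; rewrite extw_rcons.
have P0 : (0 < #|P|)%N by rewrite -sP.
rewrite (perm_big _ (permutations_rcons P0)).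
rewrite big_allpairs_dep big_enum; apply: eq_bigr => z zP.
have sPz : size w = #|P :\ z| by move: sP; rewrite (cardsD1 z P) zP => -[].
rewrite IH // mulr_suml mulr_sumr; apply: eq_big_seq => v.
rewrite mem_permutations => pv.
have sv : size v = size w by rewrite (perm_size pv) -cardE.
rewrite invw_rcons /Xw zip_rcons // big_rcons /=.
rewrite addnC exprD !mulrA; congr (_ ^+ _ * _ * _ * _).
rewrite (seq.permP pv) -size_filter size_enum_above.
by rewrite -(aboveU1_self (P := P :\ z)) ?setD1K // !inE eqxx.
Qed.

Lemma extw_enum J : extw (enum J) J =
  \sum_(s : {perm 'I_r} | perm_on J s)
     (-1) ^+ inv_on J s * \prod_(i <- enum J) X (s i) i.
Proof.
rewrite extw_permutations -?cardE // (perm_big _ (permutations_perm_on J)).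
rewrite big_map big_enum; apply: eq_bigr => s sJ.
rewrite inv_onE; congr (_ * _); rewrite /Xw -[X in zip _ X]map_id zip_map.
by rewrite big_map.
Qed.

Lemma symw_words p q :
  symw p q = \sum_(w <- words r (size p) | content w == q) Xw p w.
Proof.
elim: p q => [|z p IH] q /=.
  rewrite /symw /= big_mkcond big_seq1 /Xw big_nil eq_sym.
  have -> : content [::] = [ffun=> 0%N] :> {ffun 'I_r -> nat}.
    by apply/ffunP=> a; rewrite !ffunE.
  by case: eqP.
rewrite symw_cons big_mkcond [RHS]big_mkcond big_allpairs_dep big_enum.
apply: eq_bigr => y _.
case: ifP => qy; last first.
  rewrite big1_seq // => w _; case: eqP => // qw.
  by rewrite -qw ffunE /= eqxx in qy.
rewrite IH mulr_sumr [LHS]big_mkcond /=; apply: eq_bigr => w _.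
have -> : (content (y :: w) == q) = (content w == lower q y).
  apply/eqP/eqP => [<-|e]; apply/ffunP=> a; rewrite !ffunE /=.
    by rewrite eq_sym addKn.
  move/ffunP/(_ a): e; rewrite !ffunE => ->; rewrite eq_sym.
  by case: eqP => [->|_]; rewrite ?subn0 // subnKC.
by case: ifP => _; rewrite // /Xw /= big_cons.
Qed.

(** The sum is split by the joint content of [J] and [w]; each piece is a Koszul supertrace. *)
Lemma Ferm_Bos_degree_eq0 d : (0 < d)%N ->
  \sum_(J : {set 'I_r} | (#|J| <= d)%N) \sum_(w <- words r (d - #|J|))
     (-1) ^+ #|J| * (extw (enum J) J * Xw (sort_word w) w) = 0.
Proof.
move=> d0.
pose fits (c : {ffun 'I_r -> 'I_d.+1}) J w :=
  (J \subset supp (natfun c)) && (content w == minus (natfun c) J).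
transitivity (\sum_(J : {set 'I_r} | (#|J| <= d)%N)
    \sum_(c : {ffun 'I_r -> 'I_d.+1} | (\sum_a c a == d)%N)
    \sum_(w <- words r (d - #|J|) | fits c J w)
     (-1) ^+ #|J| * (extw (enum J) J * Xw (sort_word w) w)).
  apply: eq_bigr => J Jd; rewrite (exchange_big_dep predT) //=.
  apply: eq_big_seq => w; rewrite mem_words => /eqP sw.
  by rewrite (big_pred1 _ (content_minusE sw Jd)).
rewrite exchange_big /= big1 // => c /eqP cd.
(* Since [d] is positive, the content has a letter to contract along; it may vary with [c]. *)
have [x cx] : exists x, (0 < natfun c x)%N.
  apply/existsP; apply: contraTT d0 => /existsPn c0; rewrite -leqNgt -cd big1 // => a _.
  by apply/eqP; move: (c0 a); rewrite ffunE lt0n negbK.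
rewrite -[RHS](koszul_supertrace cx) big_mkcond [RHS]big_mkcond; apply: eq_bigr => J _.
rewrite /fits; case: (boolP (J \subset _)) => sJ; last by rewrite big_pred0_eq if_same.
have sz : (#|J| + size (word (minus (natfun c) J)) = d)%N.
  by rewrite size_word sum_minus // -[RHS]cd; apply: eq_bigr => a _; rewrite ffunE.
have -> : (#|J| <= d)%N by rewrite -[leqRHS]sz leq_addr.
have -> : (d - #|J| = size (word (minus (natfun c) J)))%N by rewrite -[X in (X - _)%N]sz addKn.
rewrite -!mulr_sumr; congr (_ * (_ * _)).
(* All words [w] of this content share one sorted word, which becomes the top row. *)
rewrite (symw_perm (p' := sort_word (word (minus (natfun c) J)))); last first.
  by rewrite perm_sym perm_sort.
rewrite symw_words size_sort; apply: eq_bigr => w /eqP wc.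
congr Xw; apply/perm_sort_wordP/perm_word => a.
by rewrite -wc ffunE.
Qed.

End Algebra.

(** * Specialisation to the right quantum algebra *)

Section RightQuantumAlgebra.
Variable r : nat.
Implicit Types (f g : series r) (al be : biword r) (J : {set 'I_r}).

Lemma to_rq_is_zmod_morphism : zmod_morphism (@to_rq r).
Proof.
by move=> f g; rewrite -[in RHS](subrK g f) [in RHS]to_rqD addrK.
Qed.

HB.instance Definition _ :=
  GRing.isZmodMorphism.Build (series r) (right_quantum r) (@to_rq r) to_rq_is_zmod_morphism.
HB.instance Definition _ :=
  GRing.isMonoidMorphism.Build (series r) (right_quantum r) (@to_rq r)
    (to_rq1 r, @to_rqM r).

Definition letter (x a : 'I_r) : right_quantum r := to_rq (biw [:: (x, a)]).

Lemma to_rq_relator f : R1_relators f \/ R2_relators f -> to_rq f = 0.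
Proof.
move=> Sf; rewrite -(raddf0 (@to_rq r)); apply/to_rqP; rewrite subr0 => n.
by exists f => // I [_]; apply.
Qed.

Lemma letter2 x y a b : letter x a * letter y b = to_rq (biw [:: (x, a); (y, b)]).
Proof. by rewrite -to_rqM [in LHS]biwM. Qed.

Lemma letter_same_bottom x y a : letter x a * letter y a = letter y a * letter x a.
Proof.
have [->//|xy] := eqVneq x y; apply/eqP; rewrite !letter2 -subr_eq0 -rmorphB.
by apply/eqP/to_rq_relator; left; exists a, x, y.
Qed.

Lemma letter_exchange x y a b :
  letter x a * letter y b + letter x b * letter y a =
  letter y a * letter x b + letter y b * letter x a.
Proof.
have [<-|ab] := eqVneq a b; first by rewrite letter_same_bottom.
have [->|xy] := eqVneq x y; first by rewrite addrC.
have : to_rq (biw [:: (x, a); (y, b)]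
    - (biw [:: (y, a); (x, b)] + biw [:: (y, b); (x, a)] - biw [:: (x, b); (y, a)])) = 0.
  by apply: to_rq_relator; right; exists a, b, x, y.
by rewrite !rmorphB rmorphD /= -!letter2 => /subr0_eq->; rewrite subrK.
Qed.

Lemma to_rq_biw al : to_rq (biw al) = \prod_(p <- al) letter p.1 p.2.
Proof.
elim: al => [|[x a] al IH]; first by rewrite big_nil.
by rewrite big_cons -IH -to_rqM [in RHS]biwM.
Qed.

Definition Ferm_on J : series r :=
  \sum_(s : {perm 'I_r} | perm_on J s) (-1) ^+ inv_on J s * biw [seq (s i, i) | i <- enum J].

Lemma to_rq_Ferm_on J : to_rq (Ferm_on J) = extw letter (enum J) J.
Proof.
rewrite rmorph_sum extw_enum; apply: eq_bigr => s _.
by rewrite rmorphM rmorph_sign /= to_rq_biw big_map.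
Qed.

Definition Bos_deg k : series r := \sum_(w <- words r k) biw (zip (sort_word w) w).

(** The part of the product of degree at most [n], as a finite sum, through which the additive map
    [to_rq] can be pushed. *)
Definition Ferm_Bos_upto n : series r :=
  \sum_(d < n.+1) \sum_(J : {set 'I_r} | (#|J| <= d)%N)
    (-1) ^+ #|J| * (Ferm_on J * Bos_deg (d - #|J|)).

Lemma to_rq_Ferm_Bos_upto n : to_rq (Ferm_Bos_upto n) = 1.
Proof.
have E d : to_rq (\sum_(J : {set 'I_r} | (#|J| <= d)%N)
      (-1) ^+ #|J| * (Ferm_on J * Bos_deg (d - #|J|))) =
    \sum_(J : {set 'I_r} | (#|J| <= d)%N) \sum_(w <- words r (d - #|J|))
      (-1) ^+ #|J| * (extw letter (enum J) J * Xw letter (sort_word w) w).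
  rewrite rmorph_sum; apply: eq_bigr => J _.
  rewrite !rmorphM rmorph_sign /= to_rq_Ferm_on rmorph_sum !mulr_sumr.
  by apply: eq_bigr => w _; rewrite /= to_rq_biw.
rewrite rmorph_sum big_ord_recl /= [X in _ + X]big1 ?addr0 => [|d _]; last first.
  by rewrite /= E (Ferm_Bos_degree_eq0 letter_same_bottom letter_exchange).
(* Degree 0 leaves only the empty set and the empty word. *)
rewrite E (big_pred1 set0) => [|J]; last by rewrite leqn0 cards_eq0.
rewrite cards0 big_seq1 enum_set0 /extw /Xw /= big_nil ffunE eqxx.
by rewrite expr0 !mulr1.
Qed.

(** * Comparison of the full product with its truncations *)

Lemma coef_sum (T : Type) (s : seq T) (P : pred T) (F : T -> series r) al :
  coef (\sum_(i <- s | P i) F i) al = \sum_(i <- s | P i) coef (F i) al.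
Proof. exact: (big_morph (fun f => coef f al)). Qed.

Lemma coef_Bos_deg k al :
  coef (Bos_deg k) al = if size al == k then coef (Bos r) al else 0.
Proof.
rewrite coef_sum /=.
have E w : (al == zip (sort_word w) w) = (bottom al == w) && (top al == sort_word (bottom al)).
  apply/eqP/andP => [->|[/eqP<- /eqP<-]]; last by rewrite /top /bottom zip_unzip.
  by rewrite /top /bottom unzip1_zip ?unzip2_zip ?eqxx // size_sort.
under eq_bigr do rewrite E.
have <- : size (bottom al) = size al by rewrite size_map.
rewrite -mem_words; case: ifP => [bw|/negP bw].
  rewrite (bigD1_seq _ bw) ?words_uniq //= eqxx big1 ?addr0 // => w.
  by rewrite eq_sym => /negbTE->.
by rewrite big1_seq // => w /= wk; case: eqP => // e; rewrite e in bw.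
Qed.

Definition vanishes_upto n f := forall al, (size al <= n)%N -> coef f al = 0.

Lemma vanishes_upto_sum n (T : Type) (s : seq T) (P : pred T) (F : T -> series r) :
  (forall i, P i -> vanishes_upto n (F i)) -> vanishes_upto n (\sum_(i <- s | P i) F i).
Proof.
by move=> v al le_n; rewrite coef_sum big1 // => i Pi; apply: v.
Qed.

Lemma vanishes_upto_mull n f g : vanishes_upto n f -> vanishes_upto n (g * f).
Proof.
move=> v al le_n /=; rewrite big1 // => i _.
by rewrite v ?mulr0 // size_drop (leq_trans (leq_subr _ _)).
Qed.

Lemma vanishes_upto_biwM n be f :
  (forall al, (size be + size al <= n)%N -> coef f al = 0) -> vanishes_upto n (biw be * f).
Proof.
move=> v al le_n /=; rewrite big1 // => i _; case: eqP => [e|_]; last by rewrite mul0r.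
by rewrite v ?mulr0 // -e -size_cat cat_take_drop.
Qed.

(** Each term of [Ferm] multiplies by a biword of length [#|J|], so up to length [n] only the parts
    of [Bos] of degree at most [n - #|J|] matter. *)
Lemma Ferm_Bos_uptoP n : vanishes_upto n (Ferm r * Bos r - Ferm_Bos_upto n).
Proof.
rewrite /Ferm_Bos_upto (exchange_big_dep predT) //= mulr_suml -sumrB.
apply: vanishes_upto_sum => J _; rewrite -mulrA -!mulr_sumr -mulrBr.
apply: vanishes_upto_mull; rewrite -mulrBr mulr_suml.
apply: vanishes_upto_sum => s _; rewrite -mulrA; apply: vanishes_upto_mull.
apply: vanishes_upto_biwM => al; rewrite size_map -cardE => le_n.
rewrite /= coef_sum; apply/eqP; rewrite subr_eq0; apply/eqP.
(* Only total degree [#|J| + size al] contributes to the coefficient at [al]. *)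
have lt_n : (#|J| + size al < n.+1)%N by [].
rewrite (bigD1 (Ordinal lt_n)) ?leq_addr //= coef_Bos_deg addKn eqxx.
rewrite big1 ?addr0 // => d /andP[Jd /eqP ne]; rewrite coef_Bos_deg; case: eqP => // e.
by case: ne; apply: val_inj; rewrite /= e subnKC.
Qed.

End RightQuantumAlgebra.

Theorem theorem1 (r : nat) (r_ge1 : (1 <= r)%N) :
  to_rq (Ferm r) * to_rq (Bos r) = 1 :> right_quantum r.
Proof.
rewrite -to_rqM; apply/to_rqP => n.
(* Membership in the closed ideal is tested at each length [n]: the approximant [g] of the
   truncation minus 1 also serves for the full product. *)
have /to_rqP/(_ n)[g Ig eg] : to_rq (Ferm_Bos_upto r n) = to_rq 1.
  by rewrite to_rq_Ferm_Bos_upto.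
exists g => // al le_n; rewrite -eg //=; congr (_ - _).
by have := Ferm_Bos_uptoP le_n; move/eqP; rewrite /= subr_eq0 => /eqP.
Qed.
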